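(* Let $d\geq 2$, $1\leq k\leq d-1$, let $A\subset\mathbb{R}^d$ have positive reach and let $a\in T_k(A)$. Then there exists $\delta>0$ such that the mapping $\psi_k^A$ is Lipschitz on $T_k(A)\cap B(a,\delta)$ (with respect to the metric $\rho_k$ on $G(d,k)$).
   Context: A set $A\subset\mathbb{R}^d$ has positive reach if there is $\varepsilon>0$ such that every $x$ with $\mathrm{dist}(x,A)<\varepsilon$ has a unique nearest point in $A$. $\operatorname{Tan}(A,x)$ is the tangent cone of $A$ at $x\in A$ ($u\in\operatorname{Tan}(A,x)$ iff $u=0$ or $r_i(x_i-x)\to u$ for some $x\neq x_i\in A$, $x_i\to x$, $r_i>0$); $\widetilde{\operatorname{Tan}}(A,x)=\operatorname{span}\operatorname{Tan}(A,x)$. $T_k(A)=\{x\in A:\dim\widetilde{\operatorname{Tan}}(A,x)=k\}$. $G(d,k)$ is the Grassmannian of $k$-dimensional linear subspaces of $\mathbb{R}^d$, with the metric $\rho_k(U,V)=\max\big(\sup_{u\in U,|u|=1}\mathrm{dist}(u,V),\sup_{v\in V,|v|=1}\mathrm{dist}(v,U)\big)$ (equivalently $\|\pi_U-\pi_V\|$ for orthogonal projections). $\psi_k^A:T_k(A)\to G(d,k)$ is $\psi_k^A(x)=\widetilde{\operatorname{Tan}}(A,x)$. *)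

(* Defs.v *)
From HB Require Import structures.
From mathcomp Require Import all_boot all_order all_algebra.
From mathcomp Require Import all_classical all_reals all_analysis.
Set Implicit Arguments. Unset Strict Implicit. Unset Printing Implicit Defensive.
Import Order.TTheory GRing.Theory Num.Theory.
Import numFieldNormedType.Exports.
Local Open Scope classical_set_scope.
Local Open Scope ring_scope.

Section Defs.
Variables (R : realType) (d : nat).
Notation vec := 'rV[R]_d.

Definition edot (u v : vec) : R := \sum_(i < d) u 0 i * v 0 i.
Definition enorm (u : vec) : R := Num.sqrt (edot u u).

Definition edist (x : vec) (A : set vec) : R :=
  inf [set enorm (x - a) | a in A].

Definition unique_nearest (A : set vec) (x : vec) : Prop :=
  exists! p : vec, A p /\ forall q, A q -> enorm (x - p) <= enorm (x - q).

Definition positive_reach (A : set vec) : Prop :=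
  exists eps : R, 0 < eps /\
    forall x : vec, edist x A < eps -> unique_nearest A x.

Definition Tan (A : set vec) (x : vec) : set vec :=
  [set u | u = 0 \/
    exists (xs : nat -> vec) (r : nat -> R),
      (forall i, A (xs i) /\ xs i != x /\ 0 < r i) /\
      ((fun i => enorm (xs i - x)) @ \oo --> (0 : R)) /\
      ((fun i => enorm (r i *: (xs i - x) - u)) @ \oo --> (0 : R))].

Definition span (S : set vec) : set vec :=
  [set v | exists (n : nat) (c : 'I_n -> R) (vs : 'I_n -> vec),
      (forall i, S (vs i)) /\ v = \sum_(i < n) c i *: vs i].

Definition Tant (A : set vec) (x : vec) : set vec := span (Tan A x).

(* V is a linear subspace of R^d of dimension k, i.e. V has a basis of
   k vectors (the rows of a rank-k k x d matrix). *)
Definition subspace_dim (V : set vec) (k : nat) : Prop :=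
  exists M : 'M[R]_(k, d), \rank M = k /\ forall v : vec, V v <-> (v <= M)%MS.

Definition T_k (A : set vec) (k : nat) : set vec :=
  [set x | A x /\ subspace_dim (Tant A x) k].

Definition rho (U V : set vec) : R :=
  Num.max (sup [set edist u V | u in [set u | U u /\ enorm u = 1]])
          (sup [set edist v U | v in [set v | V v /\ enorm v = 1]]).

Definition psi_lipschitz_on (A : set vec) (E : set vec) : Prop :=
  exists L : R, forall x y, E x -> E y ->
    rho (Tant A x) (Tant A y) <= L * enorm (x - y).

Definition eball (a : vec) (delta : R) : set vec :=
  [set x | enorm (x - a) < delta].
End Defs.

(* Main.v *)
Require Import Defs.
From HB Require Import structures.
From mathcomp Require Import all_boot all_order all_algebra.
From mathcomp Require Import all_classical all_reals all_analysis.
From mathcomp Require Import ring lra.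
Import Order.TTheory GRing.Theory Num.Theory.
Import numFieldNormedType.Exports.
Local Open Scope classical_set_scope.
Local Open Scope ring_scope.

(* Near [A] the distance function grows at unit rate away from the unique
   nearest point; maximising it over small balls shows that normal rays extend:
   if [z] is nearest to [p], it is nearest to every point of the ray from [z]
   through [p] at distance [r < eps].  The resulting empty balls give
   [2 r <p - z, b - z> <= |p - z| |b - z|^2] for [b] in [A].  Applied to the
   endpoints of a segment [[x, b]] this bounds the distance from
   [x + l (b - x)] to [A] by [C l |b - x|^2], and letting [l] tend to [0] yields
   [dist (b - x, Tan A x) <= C |b - x|^2].

   Take a basis [u_i] of [Tant A a] in [Tan A a] and fixed [b_i] in [A] with
   [r_i (b_i - a)] close to [u_i].  For [x], [y] near [a] and [s = |x - y|], let
   [z_i] be the point of [A] nearest to [x + s r_i (b_i - x)].  Then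
   [w_i = (z_i - x) / s] is close to [u_i], hence the [w_i] are uniformly
   linearly independent, and [z_i - x], [z_i - y], [x - y] are within [O(s^2)]
   of the tangent cones, so that both [Tant A x] and [Tant A y], being of
   dimension [k], are [O(s)]-close to the span of the [w_i]. *)

(* Both names are shadowed by the libraries. *)
Local Notation edist := Defs.edist.
Local Notation span := Defs.span.

(** * Euclidean inner product, norm and topology on row vectors *)

Section Euclidean.
Set Implicit Arguments.
Unset Strict Implicit.
Context {R : realType} {d : nat}.
Implicit Types (u v w x y : 'rV[R]_d) (c : R).

Lemma edotC u v : edot u v = edot v u.
Proof. by apply: eq_bigr => i _; rewrite mulrC. Qed.

Lemma edotDl u v w : edot (u + v) w = edot u w + edot v w.
Proof. by rewrite -big_split; apply: eq_bigr => i _; rewrite mxE mulrDl. Qed.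

Lemma edotZl c u v : edot (c *: u) v = c * edot u v.
Proof. by rewrite mulr_sumr; apply: eq_bigr => i _; rewrite mxE mulrA. Qed.

Lemma edotNl u v : edot (- u) v = - edot u v.
Proof. by rewrite -scaleN1r edotZl mulN1r. Qed.

Lemma edotDr u v w : edot w (u + v) = edot w u + edot w v.
Proof. by rewrite edotC edotDl !(edotC w). Qed.

Lemma edotZr c u v : edot u (c *: v) = c * edot u v.
Proof. by rewrite edotC edotZl edotC. Qed.

Lemma edotNr u v : edot u (- v) = - edot u v.
Proof. by rewrite edotC edotNl edotC. Qed.

Definition edotE := (edotDl, edotDr, edotZl, edotZr, edotNl, edotNr).

Lemma edot_ge0 u : 0 <= edot u u.
Proof. by apply: sumr_ge0 => i _; rewrite -expr2 sqr_ge0. Qed.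

Lemma enorm_ge0 u : 0 <= enorm u.
Proof. exact: sqrtr_ge0. Qed.

Lemma enorm_sqr u : enorm u ^+ 2 = edot u u.
Proof. by rewrite sqr_sqrtr // edot_ge0. Qed.

Lemma ler_coord_enorm u i : `|u 0 i| <= enorm u.
Proof.
rewrite -sqrtr_sqr ler_sqrt ?edot_ge0// /edot (bigD1 i)//= -expr2 lerDl.
by apply: sumr_ge0 => j _; rewrite -expr2 sqr_ge0.
Qed.

Lemma enorm_eq0 u : enorm u = 0 -> u = 0.
Proof.
move=> u0; apply/rowP => i; rewrite mxE; apply/normr0_eq0/le_anti.
by rewrite normr_ge0 andbT -u0 ler_coord_enorm.
Qed.

Lemma enorm0 : enorm (0 : 'rV[R]_d) = 0.
Proof. by rewrite /enorm -(scale0r 0) edotZl mul0r sqrtr0. Qed.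

Lemma enorm_gt0 u : u != 0 -> 0 < enorm u.
Proof.
by move=> u0; rewrite lt_def enorm_ge0 andbT; apply: contra_neq u0 => /enorm_eq0.
Qed.

Lemma enormZ c u : enorm (c *: u) = `|c| * enorm u.
Proof.
by rewrite /enorm edotZl edotZr mulrA -expr2 sqrtrM ?sqr_ge0// sqrtr_sqr.
Qed.

Lemma enormN u : enorm (- u) = enorm u.
Proof. by rewrite -scaleN1r enormZ normrN1 mul1r. Qed.

Lemma enormC u v : enorm (u - v) = enorm (v - u).
Proof. by rewrite -enormN opprB. Qed.

Lemma edot_le_enorm u v : edot u v <= enorm u * enorm v.
Proof.
have [->|v0] := eqVneq v 0.
  by rewrite enorm0 mulr0 -(scale0r 0) edotZr mul0r.
have vp := enorm_gt0 v0; have := edot_ge0 (enorm v *: u - enorm u *: v).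
rewrite !edotE (edotC v u) -!enorm_sqr => h.
have [u0|u0] := eqVneq u 0.
  by rewrite u0 enorm0 mul0r -(scale0r 0) edotZl mul0r.
have up := enorm_gt0 u0; have uv := mulr_gt0 up vp.
by rewrite -(ler_pM2l uv); nra.
Qed.

Lemma enorm_sqrD u v :
  enorm (u + v) ^+ 2 = enorm u ^+ 2 + 2 * edot u v + enorm v ^+ 2.
Proof. by rewrite !enorm_sqr !edotE (edotC v u); ring. Qed.

Lemma enorm_sqrB u v :
  enorm (u - v) ^+ 2 = enorm u ^+ 2 - 2 * edot u v + enorm v ^+ 2.
Proof. by rewrite enorm_sqrD enormN edotNr mulrN. Qed.

Lemma enormD u v : enorm (u + v) <= enorm u + enorm v.
Proof.
rewrite -ler_sqr ?nnegrE ?addr_ge0 ?enorm_ge0// enorm_sqrD.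
by have := edot_le_enorm u v; nra.
Qed.

Lemma enormB_le u v w : enorm (u - w) <= enorm (u - v) + enorm (v - w).
Proof. by have := enormD (u - v) (v - w); rewrite addrA subrK. Qed.

(** The norm [|u|] is the maximum of the coordinates. This comparison transfers the library topology
    to [enorm], so the crude constant [d] suffices. *)
Lemma enorm_le_norm u : enorm u <= d%:R * `|u|.
Proof.
have cu i : `|u 0 i| <= `|u|.
  rewrite -[leRHS]/(mx_norm u) mx_normrE; apply/bigmax_geP; right.
  by exists (ord0, i).
rewrite -ler_sqr ?nnegrE ?enorm_ge0 ?mulr_ge0// enorm_sqr.
apply: (@le_trans _ _ (\sum_(i < d) `|u| ^+ 2)).
  apply: ler_sum => i _; rewrite -expr2 -real_normK ?num_real//.
  by rewrite ler_sqr ?nnegrE.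
rewrite sumr_const card_ord -[leLHS]mulr_natl exprMn ler_wpM2r ?sqr_ge0//.
by rewrite -natrX ler_nat; case: (d) => // n; rewrite leq_pmulr.
Qed.

(** A one-sided bound is enough, since [x] and [y] may be exchanged. *)
Lemma lipschitz_enorm_continuous (f : 'rV[R]_d -> R) c :
  (forall x y, f x - f y <= c * enorm (x - y)) -> continuous f.
Proof.
move=> fc x; apply/(@cvgrPdist_lt _ R _ (nbhs x)) => e e0.
pose K := `|c| * d%:R + 1.
have K0 : 0 < K by rewrite ltr_wpDl ?mulr_ge0.
near=> y.
have xy : `|x - y| < e / K.
  by near: y; apply: cvgr_dist_lt => //; rewrite divr_gt0.
rewrite ltr_pdivlMr// in xy.
have h : c * enorm (x - y) < e.
  apply: le_lt_trans xy; apply: (@le_trans _ _ (`|c| * (d%:R * `|x - y|))).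
    apply: (le_trans (ler_wpM2r (enorm_ge0 _) (ler_norm c))).
    by rewrite ler_wpM2l// enorm_le_norm.
  by rewrite mulrA mulrC ler_wpM2l// lerDl.
have := fc x y; have := fc y x; rewrite (enormC y) => h1 h2.
by rewrite ltr_norml; apply/andP; split; lra.
Unshelve. all: by end_near. Qed.

Lemma enorm_dist_continuous x : continuous (fun y => enorm (x - y)).
Proof.
apply: (@lipschitz_enorm_continuous _ 1) => y z.
by rewrite mul1r lerBlDl (enormC y z) enormB_le.
Qed.

Lemma edot_continuous u x : continuous (fun y => edot u (x - y)).
Proof.
apply: (@lipschitz_enorm_continuous _ (enorm u)) => y z.
rewrite -edotNr -edotDr; apply: le_trans (edot_le_enorm _ _) _.
by rewrite opprB addrC addrA subrK enormC.
Qed.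

Lemma closed_le_continuous (f : 'rV[R]_d -> R) c :
  continuous f -> closed [set x | f x <= c].
Proof. by move=> cf; apply: (@closed_comp _ _ f [set y | y <= c]) => // ? _; exact: cf. Qed.

Lemma compact_closed_ball (A : set 'rV[R]_d) x c :
  closed A -> (forall y, A y -> enorm (x - y) <= c) -> compact A.
Proof.
move=> cA Ac; apply: bounded_closed_compact => //.
exists (enorm x + `|c|); split; first exact: num_real.
move=> M cM y /Ac xy /=; rewrite -[leLHS]/(mx_norm y) mx_normrE.
have yM : enorm y <= M.
  have := enormD x (y - x); rewrite addrC subrK (enormC y) => h.
  by have := ler_norm c; lra.
apply/bigmax_leP; split; first by rewrite (le_trans _ yM) ?enorm_ge0.
by move=> [i j] _ /=; rewrite ord1 (le_trans (ler_coord_enorm _ _)).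
Qed.

(** * The distance function to a set and its growth along a normal *)

Section Distance.
Variables (A : set 'rV[R]_d) (a0 : 'rV[R]_d).
Hypothesis A0 : A a0.

Lemma edist_le x b : A b -> edist x A <= enorm (x - b).
Proof.
move=> Ab; apply: ge_inf; last by exists b.
by exists 0 => _ [c _ <-]; exact: enorm_ge0.
Qed.

Lemma le_edist x c : (forall b, A b -> c <= enorm (x - b)) -> c <= edist x A.
Proof.
move=> h; apply: lb_le_inf; first by exists (enorm (x - a0)), a0.
by move=> _ [b Ab <-]; exact: h.
Qed.

Lemma edist_lipschitz x y : edist x A <= edist y A + enorm (x - y).
Proof.
rewrite -lerBlDr; apply: le_edist => b Ab; rewrite lerBlDr.
by apply: (le_trans (edist_le x Ab)); rewrite [leRHS]addrC enormB_le.
Qed.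

Lemma edist_to_set_continuous : continuous (fun x => edist x A).
Proof.
apply: (@lipschitz_enorm_continuous _ 1) => x y.
by rewrite mul1r lerBlDl edist_lipschitz.
Qed.

Lemma edist_eq x z : A z -> (forall b, A b -> enorm (x - z) <= enorm (x - b)) ->
  edist x A = enorm (x - z).
Proof. by move=> Az h; apply/le_anti; rewrite edist_le//= le_edist. Qed.

(* The points [b] of [A] with [edot n (q - b) <= (1 - eta) D] are the only ones
   that could spoil the growth; they form a compact set avoiding [z], hence stay
   at distance at least [m > D] from [q]. *)
Lemma edist_growth (q z : 'rV[R]_d) (eta : R)  :
  closed A -> 0 < eta -> eta < 1 -> A z -> z != q ->
  (forall b, A b -> enorm (q - z) <= enorm (q - b)) ->
  (forall b, A b -> enorm (q - b) <= enorm (q - z) -> b = z) ->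
  let n := (enorm (q - z))^-1 *: (q - z) in
  exists2 h0, 0 < h0 & forall h, 0 < h -> h <= h0 ->
    enorm (q - z) + (1 - eta) * h <= edist (q + h *: n) A.
Proof.
move=> cA eta0 eta1 Az zq nz uz n; set D := enorm (q - z) in nz uz n *.
have D0 : 0 < D by rewrite enorm_gt0// subr_eq0 eq_sym.
have n1 : enorm n = 1 by rewrite enormZ normfV gtr0_norm// mulVf ?gt_eqF.
pose K := A `&` [set b | enorm (q - b) <= D + 1] `&`
          [set b | edot n (q - b) <= (1 - eta) * D].
have [m mD mK] : exists2 m, D < m & forall b, K b -> m <= enorm (q - b).
  have cK : compact K.
    apply: (@compact_closed_ball K q (D + 1)); last by move=> y [[_ ?]].
    apply: closedI; first apply: closedI => //.
      by apply: closed_le_continuous; exact: enorm_dist_continuous.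
    by apply: closed_le_continuous; exact: edot_continuous.
  have [/eqP K0|/set0P K0] := boolP (K == set0).
    by exists (D + 1); [rewrite ltrDl|rewrite K0].
  have [c cinK cmin] := EVT_min_rV K0 cK
    (continuous_subspaceT (@enorm_dist_continuous q)).
  exists (enorm (q - c)); last by move=> b Kb; apply: cmin; rewrite inE.
  (* A minimiser at distance at most [D] would be [z] by uniqueness; but [edot n (q - z) = D]
     exceeds [(1 - eta) * D], so [z] is not in [K]. *)
  move: cinK; rewrite inE => -[[Ac _] /= cn]; rewrite ltNge; apply/negP => cD.
  move: cn; rewrite (uz c Ac cD) /n edotZl -enorm_sqr -/D expr2 mulrA mulVf ?gt_eqF//.
  by rewrite mul1r; nra.
(* The first bound gives [m - h >= D + h] for points of [K], the second [D + 1 - h >= D + h] for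
   points farther than [D + 1] from [q]. *)
exists (Num.min ((m - D) / 2) 2^-1); first by rewrite lt_min; apply/andP; split; lra.
move=> h h0; rewrite le_min => /andP[hm h2]; apply: le_edist => b Ab.
have far : enorm (q - b) - h <= enorm (q + h *: n - b).
  have := enormB_le q (q + h *: n) b.
  rewrite opprD addrA subrr add0r enormN enormZ n1 mulr1 gtr0_norm//; lra.
have eh : 0 < eta * h by exact: mulr_gt0.
have [bD|bD] := leP (enorm (q - b)) (D + 1); last by nra.
have [bn|bn] := leP (edot n (q - b)) ((1 - eta) * D).
  by have := mK b (conj (conj Ab bD) bn); nra.
have Db := nz b Ab.
(* For the remaining [b] the inner product with [n] is large, and expanding the square gives at
   least [D ^+ 2 + 2 * h * (1 - eta) * D + h ^+ 2]. *)
rewrite -ler_sqr ?nnegrE ?enorm_ge0//; last by nra.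
rewrite (_ : q + h *: n - b = (q - b) + h *: n); last by rewrite addrAC.
rewrite enorm_sqrD edotZr enormZ n1 mulr1 real_normK ?num_real// edotC.
have s1 : D ^+ 2 <= enorm (q - b) ^+ 2 by rewrite ler_sqr ?nnegrE ?enorm_ge0// ltW.
have s2 : h * ((1 - eta) * D) <= h * edot n (q - b) by rewrite ler_pM2l// ltW.
have s3 : ((1 - eta) * h) ^+ 2 <= h ^+ 2.
  by rewrite ler_sqr ?nnegrE; nra.
move: s1 s2 s3; set e1 := enorm _ ^+ 2; set e2 := edot _ _ => s1 s2 s3.
by rewrite sqrrD; lra.
Qed.
End Distance.
End Euclidean.

(** * Sets of positive reach: normal rays, segments and tangent vectors *)

Section PositiveReach.
Set Implicit Arguments.
Unset Strict Implicit.
Context {R : realType} {d : nat}.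
Variables (A : set 'rV[R]_d) (a0 : 'rV[R]_d) (eps : R).
Hypotheses (A0 : A a0) (eps0 : 0 < eps).
Hypothesis reachA : forall x, edist x A < eps -> unique_nearest A x.
Implicit Types (x y p q z b : 'rV[R]_d) (r h l : R).

(** A point [x] of the closure has a nearest point [z] in [A]; if [z] differed from [x], some point
    of [A] would be closer to [x]. *)
Lemma reach_closed : closed A.
Proof.
move=> x clx.
have near_x e : 0 < e -> exists2 b, A b & enorm (x - b) < e.
  move=> e0.
  have /clx[b [Ab xb]] : nbhs x [set b | enorm (x - b) < e].
    have /(_ x) := @enorm_dist_continuous R d x.
    move/(@cvgrPdist_lt _ R _ (nbhs x)) => /(_ e e0).
    apply: filterS => y /=; rewrite subrr enorm0 sub0r normrN ger0_norm//.
    exact: enorm_ge0.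
  by exists b.
have [b0 Ab0 xb0] := near_x eps eps0.
have [z [[Az nz] _]] := reachA (le_lt_trans (edist_le x Ab0) xb0).
have [->//|xz] := eqVneq x z.
have /near_x[b Ab] : 0 < enorm (x - z) by rewrite enorm_gt0// subr_eq0.
by rewrite ltNge nz.
Qed.

Lemma reach_nearest x : edist x A < eps ->
  exists z, [/\ A z, edist x A = enorm (x - z),
    forall b, A b -> enorm (x - z) <= enorm (x - b) &
    forall b, A b -> enorm (x - b) <= enorm (x - z) -> b = z].
Proof.
move=> /reachA[z [[Az nz] uz]]; exists z; split=> //.
  exact: (edist_eq A0).
move=> b Ab bz; rewrite -(uz b)//; split=> // c Ac.
by rewrite (le_trans bz) ?nz.
Qed.

(** The distance is maximised over the compact set [S] of points whose gain over [p] is at least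
    [1 - eta] times their displacement. A maximiser with displacement below [T] could be pushed
    along its normal by [edist_growth] without leaving [S]; the bound by [eps] supplies its unique
    nearest point. *)
Lemma edist_max_ge p (T eta : R) :
  0 < edist p A -> 0 < T -> edist p A + T < eps ->
  0 < eta -> eta < 1 ->
  exists2 q, enorm (p - q) <= T & edist p A + (1 - eta) * T <= edist q A.
Proof.
move=> p0 T0 pT eta0 eta1.
pose S := [set q | enorm (p - q) <= T] `&`
  [set q | edist p A + (1 - eta) * enorm (p - q) - edist q A <= 0].
have S0 : S !=set0.
  exists p; split => /=; first by rewrite subrr enorm0 ltW.
  by rewrite subrr enorm0 mulr0 addr0 subrr.
have cS : compact S.
  apply: (@compact_closed_ball _ _ S p T); last by move=> y [].
  apply: closedI; apply: closed_le_continuous.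
    exact: enorm_dist_continuous.
  apply: (@lipschitz_enorm_continuous _ _ _ 2) => x y.
  have := edist_lipschitz A0 y x; have := enormB_le p y x.
  rewrite (enormC y x) => h1 h2.
  have := enorm_ge0 (x - y) => h3; nra.
have [q Sq qmax] := EVT_max_rV S0 cS
  (continuous_subspaceT (@edist_to_set_continuous _ _ _ _ A0)).
move: Sq; rewrite inE => -[/= qT qS].
have pq := enorm_ge0 (p - q).
exists q => //; have [->|qT'] := eqVneq T (enorm (p - q)); first by lra.
exfalso; have {}qT : enorm (p - q) < T by rewrite lt_neqAle eq_sym qT'.
have qp : edist p A <= edist q A by nra.
have qe : edist q A < eps.
  by have := edist_lipschitz A0 q p; rewrite enormC; lra.
have [z [Az qz nz uz]] := reach_nearest qe.
have zq : z != q.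
  by apply/eqP => zq; move: qz; rewrite zq subrr enorm0; lra.
have [h0 h0p] := edist_growth A0 reach_closed eta0 eta1 Az zq nz uz.
have n1 : enorm ((enorm (q - z))^-1 *: (q - z)) = 1.
  by rewrite enormZ ger0_norm ?invr_ge0 ?enorm_ge0// mulVf// -qz gt_eqF//; lra.
move: n1; set n := _ *: _ => n1 grow.
pose h := Num.min h0 (T - enorm (p - q)).
have hp : 0 < h by rewrite lt_min h0p subr_gt0.
have hh0 : h <= h0 by rewrite ge_min lexx.
have hT : h <= T - enorm (p - q) by rewrite ge_min lexx orbT.
have {}grow := grow h hp hh0; rewrite -qz in grow.
have pq' : enorm (p - (q + h *: n)) <= enorm (p - q) + h.
  have := enormB_le p q (q + h *: n).
  have -> : q - (q + h *: n) = - (h *: n) by rewrite opprD addrA subrr add0r.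
  by rewrite enormN enormZ n1 mulr1 gtr0_norm.
have hq : edist q A < edist (q + h *: n) A by nra.
have /qmax : q + h *: n \in S.
  by rewrite inE; split => /=; [lra|nra].
by rewrite leNgt hq.
Qed.

(* A maximiser [q] of the distance over the ball of radius [T] around [p] has
   [edist q A = edist p A + T]; equality in the triangle inequality then puts
   [q] on the ray. *)
Lemma normal_ray p z r :
  A z -> (forall b, A b -> enorm (p - z) <= enorm (p - b)) ->
  0 < enorm (p - z) -> enorm (p - z) < r -> r < eps ->
  forall b, A b -> r <= enorm (z + (r / enorm (p - z)) *: (p - z) - b).
Proof.
move=> Az nz; have pz := edist_eq A0 Az nz; set D := enorm (p - z) => D0 Dr re b Ab.
pose T := r - D; have T0 : 0 < T by rewrite /T; lra.
pose B := [set q | enorm (p - q) <= T].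
have B0 : B !=set0 by exists p => /=; rewrite /B/= subrr enorm0 ltW.
have cB : compact B.
  apply: (@compact_closed_ball _ _ B p T) => //.
  by apply: closed_le_continuous; exact: enorm_dist_continuous.
have [q Bq qmax] := EVT_max_rV B0 cB
  (continuous_subspaceT (@edist_to_set_continuous _ _ _ _ A0)).
move: Bq; rewrite inE /B/= => Bq.
have qr : r <= edist q A.
  apply/ler_addgt0Pl => e e0.
  (* The loss [eta * T] in [edist_max_ge] is at most [e], which is arbitrary. *)
  pose eta := Num.min 2^-1 (e / T).
  have eta0 : 0 < eta by rewrite lt_min divr_gt0// andbT; lra.
  have eta1 : eta <= 2^-1 by rewrite ge_min lexx.
  have etaT : eta * T <= e by rewrite -ler_pdivlMr// ge_min lexx orbT.
  have pp : 0 < edist p A by rewrite pz.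
  have pT : edist p A + T < eps by rewrite pz -/D /T; lra.
  have eta1' : eta < 1 by lra.
  have [q' q'T q'd] := edist_max_ge pp T0 pT eta0 eta1'.
  have /qmax : q' \in B by rewrite inE.
  move: q'd; rewrite pz -/D /T in etaT *; nra.
have qz := edist_le q Az.
have qz' : enorm (q - z) <= T + D.
  by rewrite (le_trans (enormB_le q p z))// lerD2r enormC.
have -> : z + (r / D) *: (p - z) = q; last exact: le_trans qr (edist_le q Ab).
apply/eqP; rewrite -subr_eq0; apply/eqP/enorm_eq0/eqP.
(* With [enorm (q - z) = T + D], the squared distance from [q] to the point of the ray equals [(1 +
   T / D) * (enorm (q - p) ^+ 2 - T ^+ 2)], which is nonpositive. *)
rewrite -sqrf_eq0; apply/eqP/le_anti; rewrite sqr_ge0 andbT.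
have e1 : enorm (q - z) ^+ 2 = r ^+ 2.
  by congr (_ ^+ 2); apply/le_anti; rewrite (le_trans qr qz) andbT (le_trans qz')// /T; lra.
have e2 : q - z = (q - p) + (p - z) by rewrite addrA subrK.
have -> : z + (r / D) *: (p - z) - q = (T / D) *: (p - z) - (q - p).
  have -> : r / D = T / D + 1 by rewrite /T; field; rewrite gt_eqF.
  rewrite scalerDl scale1r; move: (_ *: _) => w.
  by apply/rowP => i; rewrite !mxE; ring.
rewrite e2 enorm_sqrD -/D in e1.
rewrite enorm_sqrB edotZl edotC enormZ exprMn real_normK ?num_real// -/D.
have -> : (T / D) ^+ 2 * D ^+ 2 = T ^+ 2 by field; rewrite gt_eqF.
have Bq2 : enorm (q - p) ^+ 2 <= T ^+ 2.
  rewrite ler_sqr ?nnegrE ?enorm_ge0 ?(ltW T0)// enormC; exact: Bq.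
have -> : edot (q - p) (p - z) = (r ^+ 2 - enorm (q - p) ^+ 2 - D ^+ 2) / 2 by lra.
set e := enorm (q - p) ^+ 2 in Bq2 *.
have -> : r = T + D by rewrite /T; ring.
have -> : T ^+ 2 - 2 * (T / D * (((T + D) ^+ 2 - e - D ^+ 2) / 2)) + e
  = (1 + T / D) * (e - T ^+ 2) by field; rewrite gt_eqF.
by rewrite mulr_ge0_le0 ?subr_le0// addr_ge0// divr_ge0// ltW.
Qed.

(** This is the expanded square of the statement that [b] lies outside the open ball of radius [r]
    touching [A] at [z] in direction [p - z]. *)
Lemma reach_normal p z b r : A z -> A b ->
  (forall c, A c -> enorm (p - z) <= enorm (p - c)) ->
  enorm (p - z) < r -> r < eps ->
  2 * r * edot (p - z) (b - z) <= enorm (p - z) * enorm (b - z) ^+ 2.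
Proof.
move=> Az Ab nz zr re.
have [pz|pz] := eqVneq p z.
  by rewrite pz subrr enorm0 mul0r -(scale0r 0) edotZl mul0r mulr0.
have D0 : 0 < enorm (p - z) by rewrite enorm_gt0// subr_eq0.
have := normal_ray Az nz D0 zr re Ab; set D := enorm (p - z) in zr D0 *.
have r0 : 0 < r by apply: lt_trans zr.
rewrite -ler_sqr ?nnegrE ?enorm_ge0 ?(ltW r0)//.
have -> : z + (r / D) *: (p - z) - b = (r / D) *: (p - z) - (b - z).
  by apply/rowP => i; rewrite !mxE; ring.
rewrite (enorm_sqrB (_ *: _)) enormZ exprMn real_normK ?num_real// -/D edotZl.
have -> : (r / D) ^+ 2 * D ^+ 2 = r ^+ 2 by field; rewrite gt_eqF.
set e := edot _ _; set n := enorm _ ^+ 2 => h.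
have {}h : 2 * (r / D * e) <= n by lra.
have := ler_wpM2l (ltW D0) h; rewrite (_ : D * (2 * _) = 2 * r * e)//.
by field; rewrite gt_eqF.
Qed.

Lemma segment_near x b l : A x -> A b -> 0 <= l -> l <= 1 ->
  enorm (b - x) < eps / 2 ->
  exists2 z, A z & enorm (z - (x + l *: (b - x))) <= 2 / eps * l * enorm (b - x) ^+ 2.
Proof.
move=> Ax Ab l0 l1 bx; have e0 := eps0; set p : 'rV[R]_d := x + l *: (b - x).
have px : enorm (p - x) <= enorm (b - x).
  by rewrite /p addrAC subrr add0r enormZ ger0_norm// ler_piMl ?enorm_ge0.
have pA : edist p A < eps.
  by apply: le_lt_trans (edist_le p Ax) (le_lt_trans px _); lra.
have [z [Az pz nz _]] := reach_nearest pA; exists z => //.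
rewrite enormC; set D := enorm (p - z).
have De : D < eps / 2 by exact: le_lt_trans (nz x Ax) (le_lt_trans px bx).
have D0 : 0 <= D by exact: enorm_ge0.
(* The radius [3 / 4 * eps] lies strictly between the bound [eps / 2] on [D] and [eps]. *)
have re : 3 / 4 * eps < eps by lra.
have Dr : enorm (p - z) < 3 / 4 * eps by rewrite -/D; lra.
have hx := reach_normal Az Ax nz Dr re.
have hb := reach_normal Az Ab nz Dr re.
have ex : x - z = (p - z) - l *: (b - x) by rewrite /p; apply/rowP => i; rewrite !mxE; ring.
have eb : b - z = (p - z) + (1 - l) *: (b - x) by rewrite /p; apply/rowP => i; rewrite !mxE; ring.
rewrite ex enorm_sqrB edotDr edotNr !edotZr enormZ exprMn -enorm_sqr
  real_normK ?num_real// -/D in hx.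
rewrite eb enorm_sqrD edotDr !edotZr enormZ exprMn -enorm_sqr
  real_normK ?num_real// -/D in hb.
move: hx hb; set e := edot _ _; set N := enorm _ ^+ 2 => hx hb.
have N0 : 0 <= N by exact: sqr_ge0.
(* With weights [1 - l] and [l] the terms containing [e] cancel. *)
have key : 3 / 2 * eps * D ^+ 2 <= D * (D ^+ 2 + l * (1 - l) * N).
  have := lerD (ler_wpM2l (_ : 0 <= 1 - l) hx) (ler_wpM2l l0 hb).
  rewrite subr_ge0 => /(_ l1); lra.
have [->|Dn] := eqVneq D 0.
  apply: mulr_ge0 => //; apply: mulr_ge0 => //. apply: divr_ge0; lra.
have Dp : 0 < D by rewrite lt_def Dn.
have key2 : 3 / 2 * eps * D <= D ^+ 2 + l * (1 - l) * N.
  by rewrite -(ler_pM2l Dp); apply: le_trans key; rewrite le_eqVlt; apply/orP; left; apply/eqP; ring.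
have -> : 2 / eps * l * N = (2 * l * N) / eps by ring.
rewrite ler_pdivlMr//.
have lN : 0 <= l * N by exact: mulr_ge0.
have l2N : 0 <= l * l * N by apply: mulr_ge0 => //; exact: mulr_ge0.
(* The quadratic term is absorbed on the left, leaving [eps * D <= l * N]. *)
have : D ^+ 2 <= D * (eps / 2) by rewrite expr2 ler_pM2l// ltW.
by nra.
Qed.

Lemma cvg0_le_harmonic (f : nat -> R) c : (forall i, 0 <= f i) ->
  (forall i, f i <= c * i.+1%:R^-1) -> f @ \oo --> (0 : R).
Proof.
move=> f0 fc; apply: (@squeeze_cvgr _ _ _ _ (fun=> 0) (fun i => c * harmonic i)).
- by near=> i; rewrite f0 fc.
- exact: cvg_cst.
- by rewrite -[X in _ --> X](mulr0 c); apply: cvgMr; exact: cvg_harmonic.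
Unshelve. all: by end_near. Qed.

(** The error in [segment_near] is linear in [l], so after rescaling by [1 / l] the points near the
    segment stay within a fixed distance of [q - x]; a cluster point as [l] tends to 0 is the
    tangent vector. *)
Lemma Tan_near x q : A x -> A q -> enorm (q - x) < eps / 2 ->
  exists2 u, Tan A x u & enorm (u - (q - x)) <= 2 / eps * enorm (q - x) ^+ 2.
Proof.
move=> Ax Aq qx; set w : 'rV[R]_d := q - x; set N := 2 / eps * _.
have /choice[z zP] n : exists z, A z /\
    enorm (z - (x + n.+1%:R^-1 *: w)) <= 2 / eps * n.+1%:R^-1 * enorm w ^+ 2.
  have [||z Az zn] := segment_near (l := n.+1%:R^-1) Ax Aq _ _ qx.
  - by rewrite invr_ge0.
  - by rewrite invf_le1 ?ltr0n// ler1n.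
  - by exists z.
pose v n : 'rV[R]_d := n.+1%:R *: (z n - x).
have vN n : enorm (w - v n) <= N.
  have -> : w - v n = - (n.+1%:R *: (z n - (x + n.+1%:R^-1 *: w))).
    rewrite /v opprD addrA [in RHS]scalerBr scalerA divff ?pnatr_eq0// scale1r.
    by rewrite opprB.
  rewrite enormN enormZ ger0_norm//.
  have := ler_wpM2l (ler0n R n.+1) (zP n).2.
  rewrite (_ : _ * (_ * _ * _) = N)//; rewrite /N.
  by rewrite mulrA; congr (_ * _); rewrite mulrCA divff ?pnatr_eq0// mulr1.
have cK : compact [set u | enorm (w - u) <= N].
  apply: (@compact_closed_ball _ _ _ w N) => //.
  by apply: closed_le_continuous; exact: enorm_dist_continuous.
have [u [/= uN cu]] : [set u | enorm (w - u) <= N] `&` cluster (v @ \oo) !=set0.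
  by apply: cK; exists 0%N => // n _; exact: vN.
have {}cu e m : 0 < e -> exists n, (m <= n)%N /\ enorm (u - v n) < e.
  move=> e0.
  have [||_ [[n /= mn <-] un]] := cu [set v n | n in [set n | (m <= n)%N]]
      [set y | enorm (u - y) < e].
  - by exists m => // n /= mn; exists n.
  - have /(_ u) := @enorm_dist_continuous R d u.
    move/(@cvgrPdist_lt _ R _ (nbhs u)) => /(_ e e0).
    apply: filterS => y /=; rewrite subrr enorm0 sub0r normrN ger0_norm//.
    exact: enorm_ge0.
  by exists n.
exists u; last by rewrite enormC.
have [->|u0] := eqVneq u 0; [by left|right].
(* Closeness below [enorm u] ensures [z (k i) != x] and [enorm (v (k i)) <= 2 * enorm u], hence
   convergence of [z (k i)] to [x]. *)
have /choice[k kP] (i : nat) : exists n, (i <= n)%N /\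
    enorm (u - v n) < Num.min i.+1%:R^-1 (enorm u).
  by apply: cu; rewrite lt_min invr_gt0 ltr0n enorm_gt0.
exists (fun i => z (k i)), (fun i => (k i).+1%:R); split; [|split].
- move=> i; split; first exact: (zP _).1.
  split; last by rewrite ltr0n.
  apply/eqP => zx; have [_] := kP i; rewrite /v zx subrr scaler0 subr0.
  by rewrite lt_min ltxx andbF.
- apply: (@cvg0_le_harmonic _ (2 * enorm u)) => i; first exact: enorm_ge0.
  have [ik] := kP i; rewrite lt_min => /andP[_ uv].
  have vu : enorm (v (k i)) <= 2 * enorm u.
    have := enormD (v (k i) - u) u; rewrite subrK (enormC _ u) => h; lra.
  rewrite ler_pdivlMr ?ltr0n// mulrC; apply: le_trans vu.
  rewrite /v enormZ ger0_norm// ler_wpM2r ?enorm_ge0// ler_nat.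
  by rewrite ltnS.
- apply: (@cvg0_le_harmonic _ 1) => i; first exact: enorm_ge0.
  by have [_] := kP i; rewrite lt_min mul1r enormC => /andP[/ltW].
Unshelve. all: by end_near. Qed.
End PositiveReach.

(** * Perturbation of bases, bases inside a spanning set, and bounds on [rho] *)

Section Subspaces.
Set Implicit Arguments.
Unset Strict Implicit.
Context {R : realType} {d : nat}.

Lemma enorm_sum n (F : 'I_n -> 'rV[R]_d) :
  enorm (\sum_i F i) <= \sum_i enorm (F i).
Proof.
elim/big_rec2: _ => [|i x y _ yx]; first by rewrite enorm0.
by rewrite (le_trans (enormD _ _))// lerD2l.
Qed.

Lemma enorm_mulmx k (c : 'rV[R]_k) (N : 'M[R]_(k, d)) e :
  (forall i, enorm (row i N) <= e) -> enorm (c *m N) <= (\sum_i `|c 0 i|) * e.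
Proof.
move=> Ne; rewrite mulmx_sum_row (le_trans (enorm_sum _))// mulr_suml.
by apply: ler_sum => i _; rewrite enormZ ler_wpM2l.
Qed.

(** A right inverse of [M] recovers the coordinates [c] from [c *m M]. *)
Lemma row_free_coord_bound k (M : 'M[R]_(k, d)) : row_free M ->
  exists2 S, 0 < S & forall c : 'rV[R]_k, \sum_i `|c 0 i| <= S * enorm (c *m M).
Proof.
move=> /row_freeP[B MB]; pose S := \sum_i \sum_j `|B j i|.
exists (S + 1); first by rewrite ltr_wpDl// sumr_ge0// => i _; rewrite sumr_ge0.
move=> c; apply: (@le_trans _ _ (S * enorm (c *m M))); last first.
  by rewrite ler_wpM2r ?enorm_ge0// lerDl.
rewrite mulr_suml; apply: ler_sum => i _.
rewrite -[c in leLHS]mulmx1 -MB mulmxA mxE (le_trans (ler_norm_sum _ _ _))//.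
rewrite mulr_suml; apply: ler_sum => j _; rewrite normrM mulrC ler_wpM2l//.
exact: ler_coord_enorm.
Qed.

(** Doubling the constant for [M] makes the perturbation cost at most half of the coordinate sum,
    which is absorbed on the left. *)
Lemma row_free_perturb k (M : 'M[R]_(k, d)) : row_free M ->
  exists2 S, 0 < S & forall P : 'M[R]_(k, d),
    (forall i, enorm (row i P - row i M) <= S^-1) ->
    forall c : 'rV[R]_k, \sum_i `|c 0 i| <= S * enorm (c *m P).
Proof.
move=> /row_free_coord_bound[S S0 MS]; exists (2 * S); first by rewrite mulr_gt0.
move=> P PM c; set n := \sum_i _.
have h1 : enorm (c *m (P - M)) <= n * (2 * S)^-1.
  by apply: enorm_mulmx => i; rewrite linearB; exact: PM.
have h2 : enorm (c *m M) <= enorm (c *m P) + enorm (c *m (P - M)).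
  rewrite -[enorm (c *m (P - M))]enormN; apply: le_trans (enormD _ _).
  by rewrite mulmxBr opprB addrC subrK.
have h3 : S * (n * (2 * S)^-1) = n / 2 by field; rewrite gt_eqF.

have := ler_wpM2l (ltW S0) h1; have := ler_wpM2l (ltW S0) h2; have := MS c.
by rewrite h3 -/n; lra.
Qed.

(** Being near [M], the rows of [P] are independent, so by dimension they form a basis of [U];
    [u = c *m P] is then approximated by [c *m Q]. The constant depends on [M] alone. *)
Lemma subspace_approx k (M : 'M[R]_(k, d)) : row_free M ->
  exists2 S, 0 < S & forall (U V : set 'rV[R]_d) (P Q : 'M[R]_(k, d)) (e : R),
    subspace_dim U k -> subspace_dim V k ->
    (forall i, U (row i P)) -> (forall i, V (row i Q)) ->
    (forall i, enorm (row i P - row i M) <= S^-1) ->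
    (forall i, enorm (row i P - row i Q) <= e) ->
    forall u, U u -> enorm u = 1 -> exists2 v, V v & enorm (u - v) <= S * e.
Proof.
move=> /row_free_perturb[S S0 MS]; exists S => //.
move=> U V P Q e [MU [rU UE]] [MV [rV VE]] UP VQ PM PQ u Uu u1.
have {}MS := MS P PM.
have fP : row_free P.
  apply: inj_row_free => c cP; apply/rowP => i; rewrite mxE; apply/normr0_eq0/le_anti.
  rewrite normr_ge0 andbT; have := MS c; rewrite cP enorm0 mulr0; apply: le_trans.
  by rewrite (bigD1 i)//= lerDl sumr_ge0.
have PU : (P <= MU)%MS by apply/row_subP => i; apply/UE; exact: UP.
have UsP : (MU <= P)%MS.
  by rewrite -(mxrank_leqif_sup PU) rU; rewrite -row_leq_rank in fP; rewrite eqn_leq fP rank_leq_row.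
have /submxP[c uc] : (u <= P)%MS by apply: submx_trans UsP; apply/UE.
exists (c *m Q).
  apply/VE; apply: submx_trans (submxMl _ _) _.
  by apply/row_subP => i; apply/VE; exact: VQ.
rewrite uc -mulmxBr; apply: (@le_trans _ _ ((\sum_i `|c 0 i|) * e)).
  by apply: enorm_mulmx => i; rewrite linearB; exact: PQ.
(* The sign of [e] is read off a row; without rows, [U] has no unit vector. *)
have [k0|k0] := posnP k.
  move: u1; rewrite uc mulmx_sum_row big1 ?enorm0 => [/esym/eqP|i _].
    by rewrite oner_eq0.
  by have := ltn_ord i; rewrite {2}k0.
rewrite ler_wpM2r//; first exact: le_trans (enorm_ge0 _) (PQ (Ordinal k0)).
by have := MS c; rewrite -uc u1 mulr1.
Qed.

(** Greedy extension: while fewer than [k] rows are chosen, some element of [S] lies outside their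
    span. *)
Lemma span_row_free (S : set 'rV[R]_d) k : subspace_dim (span S) k ->
  exists2 M : 'M[R]_(k, d), row_free M & forall i, S (row i M).
Proof.
move=> [MU [rU UE]].
suff : forall j, (j <= k)%N ->
    exists2 M : 'M[R]_(j, d), row_free M & forall i, S (row i M) by apply.
elim=> [_|j IH jk].
  exists 0 => [|[]//]; rewrite -row_leq_rank; exact: leq0n.
have [M fM SM] := IH (ltnW jk).
have [s [Ss sM]] : exists s, S s /\ ~~ (s <= M)%MS.
  apply: contrapT => /forallNP h.
  have UM : (MU <= M)%MS.
    apply/row_subP => i; have /UE[n [c [vs [Svs ->]]]] := row_sub i MU.
    apply: summx_sub => l _; apply: scalemx_sub; apply/negPn/negP => hl.
    exact: (h (vs l)).
  have := mxrankS UM; rewrite rU leqNgt => /negP; apply.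
  exact: leq_ltn_trans (rank_leq_row M) jk.
have fN : row_free (col_mx s M).
  apply: inj_row_free => v; rewrite -[v]hsubmxK mul_row_col => /eqP.
  rewrite addr_eq0 => /eqP ab.
  have a0 : lsubmx v = 0.
    apply: contraNeq sM => a0.
    have a00 : lsubmx v 0 0 != 0.
      apply: contra_neq a0 => a0; apply/rowP => i; rewrite ord1 a0.
      by rewrite [RHS]mxE.
    have : (lsubmx v *m s <= M)%MS by rewrite ab -mulNmx submxMl.
    rewrite [lsubmx v]mx11_scalar mul_scalar_mx => h.
    by rewrite -[s]scale1r -(mulVf a00) -scalerA scalemx_sub.
  rewrite a0 mul0mx in ab; move/esym/eqP: ab; rewrite oppr_eq0 => /eqP bM.
  have -> : rsubmx v = 0 by apply: (row_free_inj fM); rewrite bM mul0mx.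
  by rewrite a0 row_mx0.
have SN (i : 'I_(1 + j)) : S (row i (col_mx s M)).
  have [l ->|l ->] := split_ordP i; last by rewrite rowKd.
  by rewrite rowKu ord1 row_id.
by exists (col_mx s M).
Qed.

Lemma span_incl (S : set 'rV[R]_d) u : S u -> span S u.
Proof.
move=> Su; exists 1%N, (fun=> 1), (fun=> u); split=> //.
by rewrite big_ord1 scale1r.
Qed.

Lemma subspace_dim_lin (V : set 'rV[R]_d) k c (u v : 'rV[R]_d) :
  subspace_dim V k -> V u -> V v -> V (c *: (u - v)).
Proof.
move=> [M [_ VE]] /VE uM /VE vM; apply/VE/scalemx_sub.
by apply: addmx_sub => //; rewrite eqmx_opp.
Qed.

Lemma Tan_approx (A : set 'rV[R]_d) a u (tau eta : R) : A a -> Tan A a u ->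
  0 < tau -> 0 < eta -> exists b r, [/\ A b, 0 < r, enorm (b - a) < tau &
    enorm (r *: (b - a) - u) < eta].
Proof.
move=> Aa [->|[xs [r [Axs [cx cr]]]]] tau0 eta0.
  by exists a, 1; rewrite subrr scaler0 subr0 enorm0.
move/cvgrPdist_lt: cx => /(_ _ tau0) cx; move/cvgrPdist_lt: cr => /(_ _ eta0) cr.
have [i []] := filter_ex (filterI cx cr).
rewrite /= !sub0r !normrN !ger0_norm ?enorm_ge0// => h1 h2.
by have [h3 [_ h4]] := Axs i; exists (xs i), (r i).
Qed.

Lemma rho_le (U V : set 'rV[R]_d) c : 0 <= c ->
  (forall u, U u -> enorm u = 1 -> exists2 v, V v & enorm (u - v) <= c) ->
  (forall v, V v -> enorm v = 1 -> exists2 u, U u & enorm (v - u) <= c) ->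
  rho U V <= c.
Proof.
have half (X Y : set 'rV[R]_d) : 0 <= c ->
    (forall u, X u -> enorm u = 1 -> exists2 v, Y v & enorm (u - v) <= c) ->
    sup [set edist u Y | u in [set u | X u /\ enorm u = 1]] <= c.
  move=> c0 h; set E := [set _ | _ in _].
  (* The supremum of the empty set is 0, which is where [0 <= c] enters. *)
  have [/eqP ->|/set0P E0] := boolP (E == set0); first by rewrite sup0.
  apply: ge_sup => // _ [u [Xu u1] <-]; have [v Yv uv] := h u Xu u1.
  exact: le_trans (edist_le u Yv) uv.
by move=> c0 h1 h2; rewrite /rho ge_max !half.
Qed.

End Subspaces.

(** * Transfer of tangent vectors between base points and the Lipschitz estimate *)

Section Lipschitz.
Set Implicit Arguments.
Unset Strict Implicit.
Context {R : realType} {d : nat}.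
Variables (A : set 'rV[R]_d) (eps : R).
Hypothesis eps0 : 0 < eps.
Hypothesis reachA : forall x, edist x A < eps -> unique_nearest A x.

(* The three tangent vectors approximate [z - x], [z - y] and [x - y], where [z]
   is the point of [A] nearest to [x + s r (b - x)]. *)
Lemma Tan_transfer (x y b u : 'rV[R]_d) (r t eta B : R) :
  let s := enorm (x - y) in
  A x -> A y -> A b -> 0 < r -> 0 < s -> s * r <= 1 ->
  enorm (b - x) <= t -> t < eps / 2 -> enorm (r *: (b - x) - u) <= 2 * eta ->
  enorm u + 2 * eta <= B -> 2 / eps * B * t <= eta -> eta <= 1 ->
  s * (B + 2) < eps / 2 ->
  exists g0 g1 g2, [/\ Tan A x g0, Tan A y g1, Tan A y g2,
    enorm (g0 - s *: u) <= s * (3 * eta + s * (2 / eps * (B + 1) ^+ 2)) &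
    enorm (g0 - (g1 - g2)) <= s * (s * (4 / eps * ((B + 2) ^+ 2 + 1)))].
Proof.
move=> s Ax Ay Ab r0 s0 sr bx te rbu uB Bt eta1 sB.
have C0 : 0 <= 2 / eps by rewrite divr_ge0// ltW.
set C := 2 / eps in C0 Bt *.
have -> : 4 / eps = 2 * C by rewrite /C; field; rewrite gt_eqF.
have rbB : enorm (r *: (b - x)) <= B.
  have := enormD (r *: (b - x) - u) u; rewrite subrK => h; lra.
have B0 : 0 <= B by apply: le_trans rbB; exact: enorm_ge0.
have bx0 := enorm_ge0 (b - x).
have sr0 : 0 <= s * r by rewrite mulr_ge0 ?ltW.
have [z Az zp] := segment_near Ax eps0 reachA Ax Ab sr0 sr (le_lt_trans bx te).
rewrite enormZ gtr0_norm// in rbB.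
(* The segment parameter is [l = s * r]; one factor [enorm (b - x)] combines with [r] to give [B],
   the other is at most [t]. *)
have {}zp : enorm (z - x - s *: (r *: (b - x))) <= s * eta.
  rewrite scalerA -addrA -opprD; apply: le_trans zp _; rewrite -/C.
  have -> : C * (s * r) * enorm (b - x) ^+ 2 =
    s * (C * (r * enorm (b - x)) * enorm (b - x)) by ring.
  rewrite ler_pM2l//; apply: le_trans Bt; apply: ler_pM => //.
    by rewrite mulr_ge0// mulr_ge0// ltW.
  by rewrite ler_wpM2l.
have zx : enorm (z - x) <= s * (B + 1).
  have := enormD (z - x - s *: (r *: (b - x))) (s *: (r *: (b - x))).
  rewrite subrK !enormZ (gtr0_norm s0) (gtr0_norm r0).
  have := ler_wpM2l (ltW s0) rbB; have := ler_wpM2l (ltW s0) eta1; lra.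
have zy : enorm (z - y) <= s * (B + 2).
  by have := enormB_le z x y; rewrite -/s; lra.
have sq c e : 0 <= c -> c <= s * e -> C * c ^+ 2 <= s * (s * (C * e ^+ 2)).
  move=> c0 ce; have -> : s * (s * (C * e ^+ 2)) = C * (s * e) ^+ 2 by ring.
  by rewrite ler_wpM2l// ler_sqr// nnegrE (le_trans c0).
have zxe : enorm (z - x) < eps / 2 by lra.
have zye : enorm (z - y) < eps / 2 by lra.
have se : s < eps / 2.
  by apply: le_lt_trans sB; rewrite ler_peMr ?ltW//; lra.
have [g0 T0 g0z] := Tan_near Ax eps0 reachA Ax Az zxe.
have [g1 T1 g1z] := Tan_near Ax eps0 reachA Ay Az zye.
have [g2 T2 g2z] := Tan_near Ax eps0 reachA Ay Ax se.
have {}g0z := le_trans g0z (sq _ _ (enorm_ge0 _) zx).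
have {}g1z := le_trans g1z (sq _ _ (enorm_ge0 _) zy).
have {}g2z := le_trans g2z (sq _ 1 (enorm_ge0 _) _).
rewrite mulr1 -/s lexx in g2z; have {}g2z := g2z isT.
exists g0, g1, g2; split => //.
  have -> : g0 - s *: u = (g0 - (z - x)) + (z - x - s *: (r *: (b - x)))
      + s *: (r *: (b - x) - u).
    by rewrite scalerBr; apply/rowP => i; rewrite !mxE; ring.
  apply: le_trans (enormD _ _) _; rewrite enormZ (gtr0_norm s0).
  have := enormD (g0 - (z - x)) (z - x - s *: (r *: (b - x))).
  have := ler_wpM2l (ltW s0) rbu; lra.
(* The identity [z - x = (z - y) - (x - y)] leaves only the three quadratic errors. *)
have -> : g0 - (g1 - g2) = (g0 - (z - x)) - (g1 - (z - y)) + (g2 - (x - y)).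
  by apply/rowP => i; rewrite !mxE; ring.
apply: le_trans (enormD _ _) _.
have := enormD (g0 - (z - x)) (- (g1 - (z - y))); rewrite enormN => h.
have h0 : s * (s * (C * (B + 1) ^+ 2)) <= s * (s * (C * (B + 2) ^+ 2)).
  by rewrite ler_pM2l// ler_pM2l// ler_wpM2l// ler_sqr ?nnegrE; lra.
have h1 : 0 <= s * (s * C).
  by apply: mulr_ge0 (ltW s0) _; exact: mulr_ge0 (ltW s0) C0.
have h2 : s * (s * (C * 1 ^+ 2)) = s * (s * C) by ring.
have h3 : s * (s * (2 * C * ((B + 2) ^+ 2 + 1))) =
  2 * (s * (s * (C * (B + 2) ^+ 2))) + 2 * (s * (s * C)) by ring.
by lra.
Qed.

Lemma exists_pos_lower_bound (l : seq R) : all (fun c => 0 < c) l ->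
  exists2 e : R, 0 < e & all (fun c => e <= c) l.
Proof.
elim: l => [_|c l IH /= /andP[c0 /IH[e e0 el]]]; first by exists 1.
exists (Num.min c e); first by rewrite lt_min c0.
rewrite ge_min lexx/=; apply: sub_all el => x ex.
by rewrite ge_min ex orbT.
Qed.

(** This bounds one half of [rho]; as [delta] and [L] are chosen before [x] and [y], exchanging the
    points gives the other half. *)
Lemma Tant_one_sided k a : T_k A k a ->
  exists delta L : R, [/\ 0 < delta, 0 <= L & forall x y,
    T_k A k x -> T_k A k y -> enorm (x - a) < delta -> enorm (y - a) < delta ->
    forall u, Tant A x u -> enorm u = 1 ->
      exists2 v, Tant A y v & enorm (u - v) <= L * enorm (x - y)].
Proof.
move=> [Aa dTa]; have e0 := eps0.
have [M fM TM] := span_row_free dTa.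
have [S S0 HS] := subspace_approx fM.
pose B := \sum_i enorm (row i M) + 2.
have MB i : enorm (row i M) + 2 <= B.
  rewrite lerD2r (bigD1 i)//= lerDl; apply: sumr_ge0 => j _; exact: enorm_ge0.
have B0 : 2 <= B by rewrite lerDr; apply: sumr_ge0 => j _; exact: enorm_ge0.
pose C := 2 / eps; have C0 : 0 < C by rewrite divr_gt0.
pose E := 4 / eps * ((B + 2) ^+ 2 + 1).
have E0 : 0 < E by rewrite mulr_gt0 ?divr_gt0// ltr_wpDl ?sqr_ge0.
(* The total error at the basis vectors will be at most [4 * eta], within the tolerance [S^-1] of
   [subspace_approx]. *)
have [eta eta0 /and3P[eta1 etaS _]] :
    exists2 e : R, 0 < e & all (fun c => e <= c) [:: 1; S^-1 / 4].
  by apply: exists_pos_lower_bound; rewrite /= ltr01 !divr_gt0 ?invr_gt0.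
have CB0 : 0 < C * B by rewrite mulr_gt0//; lra.
have [tau tau0 /and3P[tau1 tau2 _]] :
    exists2 e : R, 0 < e & all (fun c => e <= c) [:: eta / (C * B) / 2; eps / 8].
  by apply: exists_pos_lower_bound; rewrite /= !divr_gt0.
have /choice[br brP] (i : 'I_k) : exists br : 'rV[R]_d * R,
    [/\ A br.1, 0 < br.2, enorm (br.1 - a) < tau &
      enorm (br.2 *: (br.1 - a) - row i M) < eta].
  have [b [r h]] := Tan_approx Aa (TM i) tau0 eta0; by exists (b, r).
pose rr := \sum_i (br i).2 + 1.
have rrP i : (br i).2 <= rr.
  rewrite /rr (bigD1 i)//= -addrA lerDl addr_ge0// sumr_ge0// => j _.
  by have [_ /ltW] := brP j.
have rr0 : 0 < rr.
  by rewrite ltr_wpDl// sumr_ge0// => j _; have [_ /ltW] := brP j.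
(* As [s < 2 * delta], the bounds give in turn [enorm (b - x) <= 2 * tau], a cost of at most [eta]
   for moving the base point from [a] to [x], [s * r <= 1], [s * (B + 2) < eps / 2] and
   [s * E <= eta]. *)
have [delta delta0 /and5P[d1 d2 d3 d4 /andP[d5 _]]] :
    exists2 e : R, 0 < e & all (fun c => e <= c)
      [:: tau; eta / rr; 1 / rr / 2; eps / (B + 2) / 8; eta / E / 2].
  by apply: exists_pos_lower_bound; rewrite /= tau0 !divr_gt0//; lra.
exists delta, (S * E); split => //; first by rewrite mulr_ge0 ?ltW.
move=> x y [Ax dTx] [Ay dTy] xa ya u Txu u1.
have [xy|xy] := eqVneq x y.
  by exists u; rewrite ?xy ?subrr ?enorm0 ?mulr0// -xy.
pose s := enorm (x - y).
have s0 : 0 < s by rewrite enorm_gt0// subr_eq0.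
have s2 : s < 2 * delta.
  by have := enormB_le x a y; rewrite (enormC a y) -/s; lra.
have d2r : delta * rr <= eta by rewrite -ler_pdivlMr.
have d3r : 2 * delta * rr <= 1.
  by rewrite -ler_pdivlMr//; lra.
have d4r : 8 * delta * (B + 2) <= eps.
  by rewrite -ler_pdivlMr; lra.
have d5r : 2 * delta * E <= eta.
  by rewrite -ler_pdivlMr//; lra.
have t1r : 2 * tau * (C * B) <= eta.
  by rewrite -ler_pdivlMr//; lra.
have sE : s * E <= eta by apply: le_trans d5r; rewrite ler_pM2r// ltW.
have /choice[g gP] (i : 'I_k) : exists g : 'rV[R]_d * 'rV[R]_d,
    [/\ Tant A x g.1, Tant A y g.2, enorm (g.1 - row i M) <= S^-1 &
      enorm (g.1 - g.2) <= s * E].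
  have [Ab r0 ba bu] := brP i; set b := (br i).1 in Ab ba bu *.
  set r := (br i).2 in r0 bu *; have rP : r <= rr := rrP i.
  have := Tan_transfer (x := x) (y := y) (b := b) (u := row i M) (r := r)
    (t := 2 * tau) (eta := eta) (B := B) Ax Ay Ab r0 s0.
  rewrite -/s -/E -/C => h.
  have bx : enorm (b - x) <= 2 * tau.
    by have := enormB_le b a x; rewrite (enormC a x); lra.
  have srr : s * r <= 1.
    by apply: le_trans d3r; apply: ler_pM => //; exact: ltW.
  have t2 : 2 * tau < eps / 2 by lra.
  have rbx : enorm (r *: (b - x) - row i M) <= 2 * eta.
    have -> : r *: (b - x) - row i M = (r *: (b - a) - row i M) + r *: (a - x).
      by apply/rowP => j; rewrite !mxE; ring.
    apply: le_trans (enormD _ _) _; rewrite enormZ (gtr0_norm r0) (enormC a).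
    have : r * enorm (x - a) <= delta * rr.
      by rewrite mulrC; apply: ler_pM => //; [exact: enorm_ge0|exact: ltW|exact: ltW].
    by lra.
  have uB : enorm (row i M) + 2 * eta <= B by have := MB i; lra.
  have CBt : C * B * (2 * tau) <= eta by rewrite mulrC.
  have sB : s * (B + 2) < eps / 2.
    have : s * (B + 2) < 2 * delta * (B + 2) by rewrite ltr_pM2r//; lra.
    by lra.
  have [g0 [g1 [g2 [T0 T1 T2 g0u g01]]]] :=
    h srr bx t2 rbx uB CBt eta1 sB.
  (* Dividing by [s] turns the quadratic error into a linear one. The difference [g1 - g2] need only
     lie in the span of the tangent cone at [y]. *)
  exists (s^-1 *: g0, s^-1 *: (g1 - g2)); split => /=.
  - rewrite -[g0]subr0; apply: (subspace_dim_lin _ dTx (span_incl T0)).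
    by apply: (@span_incl _ _ (Tan A x)); left.
  - exact: (subspace_dim_lin _ dTy (span_incl T1) (span_incl T2)).
  - rewrite -(ler_pM2l s0) -{1}(gtr0_norm s0) -enormZ scalerBr scalerA.
    rewrite divff ?gt_eqF// scale1r; apply: le_trans g0u _.
    rewrite ler_pM2l//.
    have : s * (C * (B + 1) ^+ 2) <= s * E.
      rewrite ler_pM2l// /E (_ : 4 / eps = 2 * C); last by rewrite /C; ring.
      have : (B + 1) ^+ 2 <= (B + 2) ^+ 2 by rewrite ler_sqr ?nnegrE; lra.
      move=> hB; have := ler_wpM2l (ltW C0) hB.
      have := mulr_ge0 (ltW C0) (sqr_ge0 (B + 2)).
      by lra.
    by lra.
  - rewrite -(ler_pM2l s0) -{1}(gtr0_norm s0) -enormZ -scalerBr scalerA.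
    by rewrite divff ?gt_eqF// scale1r.
have := HS (Tant A x) (Tant A y) (\matrix_i (g i).1) (\matrix_i (g i).2) (s * E) dTx dTy.
rewrite -mulrA [E * _]mulrC; apply => // i; rewrite ?rowK; by have [] := gP i.
Qed.

End Lipschitz.

Theorem theorem3p11 (R : realType) (d k : nat) (A : set 'rV[R]_d)
    (a : 'rV[R]_d) :
  (2 <= d)%N -> (1 <= k)%N -> (k <= d - 1)%N ->
  positive_reach A -> T_k A k a ->
  exists delta : R, 0 < delta /\
    psi_lipschitz_on A (T_k A k `&` eball a delta).
Proof.
move=> _ _ _ [eps [eps0 reachA]] Ta.
have [delta [L [delta0 L0 H]]] := Tant_one_sided eps0 reachA Ta.
exists delta; split=> //; exists L => x y [Tx xa] [Ty ya].
apply: rho_le; first by rewrite mulr_ge0 ?enorm_ge0.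
  exact: H.
by rewrite enormC; exact: H.
Qed.
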